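(* Let $V\subset\mathbb C^N$ be an irreducible algebraic variety defined over $\mathbb Q$ and let $\mathbf l$ be a generic point of $V$. Let $\mathbf E:\mathbb C^N\to\mathbb C^{k}$ be a linear map defined over $\mathbb Q$ (i.e. given by a matrix with rational entries) and let $W\subset\mathbb C^{k}$ be an algebraic variety defined over $\mathbb Q$ such that $\mathbf E(\mathbf l)\in W$. Then $\mathbf E(V)\subset W$.
   Context: A variety in $\mathbb C^N$ is the common zero set of finitely many polynomials with complex coefficients; it is defined over $\mathbb Q$ if it can be defined by polynomials with rational coefficients. It is irreducible if it is not the union of two varieties neither of which contains the other. A point of an irreducible variety $V$ defined over $\mathbb Q$ is generic in $V$ if its coordinates satisfy no polynomial equation with rational coefficients other than those satisfied by every point of $V$. *)

(* Defs.v *)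
From mathcomp Require Import all_boot all_order all_algebra.
From mathcomp Require Import classical_sets reals complex.
From mathcomp Require Import mpoly.

Set Implicit Arguments.
Unset Strict Implicit.
Unset Printing Implicit Defensive.

Import Order.TTheory GRing.Theory Num.Theory.

Local Open Scope classical_set_scope.
Local Open Scope ring_scope.

(* A real type is a complete Archimedean ordered field, hence unique up to
   isomorphism, and [R[i]] is its field of complex numbers. *)

Section Varieties.
Variable R : realType.
Local Notation C := R[i].

Definition zero_set (N : nat) (ps : seq {mpoly C[N]}) : set 'cV[C]_N :=
  [set x | forall p, p \in ps -> p.@[fun i => x i ord0] = 0].

Definition complexify (N : nat) (p : {mpoly rat[N]}) : {mpoly C[N]} :=
  map_mpoly ratr p.

Definition variety (N : nat) (V : set 'cV[C]_N) : Prop :=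
  exists ps : seq {mpoly C[N]}, V = zero_set ps.

Definition variety_over_rat (N : nat) (V : set 'cV[C]_N) : Prop :=
  exists ps : seq {mpoly rat[N]}, V = zero_set [seq complexify p | p <- ps].

(* The two pieces range over complex varieties, not only those defined over
   the rationals. *)
Definition irreducible_variety (N : nat) (V : set 'cV[C]_N) : Prop :=
  variety V /\
  ~ (exists A B : set 'cV[C]_N,
      [/\ variety A, variety B, V = A `|` B, ~ A `<=` B & ~ B `<=` A]).

Definition generic_point (N : nat) (V : set 'cV[C]_N) (l : 'cV[C]_N) : Prop :=
  V l /\
  forall p : {mpoly rat[N]},
    (complexify p).@[fun i => l i ord0] = 0 ->
    forall x, V x -> (complexify p).@[fun i => x i ord0] = 0.

Definition linear_over_rat (N k : nat) (E : {linear 'cV[C]_N -> 'cV[C]_k}) :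
    Prop :=
  exists M : 'M[rat]_(k, N), forall x, E x = map_mx ratr M *m x.

End Varieties.

(* Main.v *)
Require Import Defs.
From mathcomp Require Import all_boot all_order all_algebra.
From mathcomp Require Import classical_sets reals complex.
From mathcomp Require Import mpoly.

(** A polynomial [p] with rational coefficients that vanishes on [W] pulls back
    along the rational matrix [M] of [E] to the polynomial [p] composed with the
    linear forms given by the rows of [M]. This pullback again has rational
    coefficients, and it vanishes at [l] because [E l] lies in [W]; genericity
    of [l] spreads its vanishing to all of [V], that is, [p] vanishes on [E V].
    The point that carries the argument is [meval_complexify_pullback]: the
    pullback, formed over the rationals, has the expected values at complex
    points. *)

Local Open Scope classical_set_scope.
Local Open Scope ring_scope.

Import GRing.Theory.

Definition linear_forms {k N : nat} (M : 'M[rat]_(k, N)) :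
    k.-tuple {mpoly rat[N]} :=
  [tuple \sum_(j < N) M i j *: 'X_j | i < k].

Lemma meval_complexify_linear_form (R : realType) (k N : nat)
    (M : 'M[rat]_(k, N)) (i : 'I_k) (x : 'cV[R[i]]_N) :
  (complexify R (tnth (linear_forms M) i)).@[fun j => x j ord0] =
  (map_mx ratr M *m x) i ord0.
Proof.
rewrite tnth_mktuple /complexify [map_mpoly _ _]raddf_sum raddf_sum mxE /=.
apply: eq_bigr => j _.
by rewrite map_mpolyZ map_mpolyX mevalZ mevalXU mxE.
Qed.

(** Extension of scalars commutes with composition of polynomials, so the
    values of the rational pullback can be computed after passing to complex
    coefficients, where evaluation is substitution. *)
Lemma meval_complexify_pullback (R : realType) (k N : nat)
    (M : 'M[rat]_(k, N)) (p : {mpoly rat[k]}) (x : 'cV[R[i]]_N) :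
  (complexify R (p \mPo linear_forms M)).@[fun j => x j ord0] =
  (complexify R p).@[fun i => (map_mx ratr M *m x) i ord0].
Proof.
rewrite {1}/complexify map_mpoly_comp; last exact: fmorph_inj.
rewrite comp_mpoly_meval; apply: meval_eq => i.
by rewrite tnth_map -meval_complexify_linear_form.
Qed.

Theorem theorem1p1 (R : realType) (N k : nat)
    (V : set 'cV[R[i]]_N) (l : 'cV[R[i]]_N)
    (E : {linear 'cV[R[i]]_N -> 'cV[R[i]]_k}) (W : set 'cV[R[i]]_k) :
  irreducible_variety V ->
  variety_over_rat V ->
  generic_point V l ->
  linear_over_rat E ->
  variety_over_rat W ->
  W (E l) ->
  E @` V `<=` W.
Proof.
move=> _ _ [_ gen_l] [M EM] [ps ->] WEl _ [x Vx <-] _ /mapP[p p_in ->].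
rewrite EM -meval_complexify_pullback; apply: gen_l Vx.
by rewrite meval_complexify_pullback -EM; apply: WEl; apply: map_f.
Qed.
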